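(* Let $X$ be a regular topological space, $Y$ a topological space, and $f:X\to Y$ a continuous surjection that is $e^*\theta$-open and $ge^*\theta$-closed. Then $Y$ is $e^*\theta$-regular.
   Context: For a subset $A$ of a topological space $X$, $cl(A)$ and $int(A)$ denote closure and interior. The $\delta$-closure $cl_\delta(A)$ is the set of points $x\in X$ such that $int(cl(U))\cap A\neq\emptyset$ for every open $U$ containing $x$. $A$ is $e^*$-open if $A\subseteq cl(int(cl_\delta(A)))$; complements of $e^*$-open sets are $e^*$-closed; $e^*\text{-}cl(A)$ is the intersection of all $e^*$-closed sets containing $A$. The $e^*$-$\theta$-closure $e^*\text{-}cl_\theta(A)$ is the set of points $x\in X$ such that $e^*\text{-}cl(U)\cap A\neq\emptyset$ for every $e^*$-open set $U$ containing $x$. $A$ is $e^*$-$\theta$-closed if $A=e^*\text{-}cl_\theta(A)$; complements of $e^*$-$\theta$-closed sets are called $e^*$-$\theta$-open. $A$ is $ge^*\theta$-closed (generalized $e^*\theta$-closed) if $e^*\text{-}cl_\theta(A)\subseteq U$ whenever $A\subseteq U$ and $U$ is open in $X$. A function $f:X\to Y$ is $e^*\theta$-open if the image of each open set of $X$ is $e^*$-$\theta$-open in $Y$; it is $ge^*\theta$-closed if the image of each closed set of $X$ is $ge^*\theta$-closed in $Y$. A space is regular if for each closed $F$ and each $x\notin F$ there are disjoint open sets $U\supseteq F$ and $V\ni x$ (no $T_1$ assumption). A space is $e^*\theta$-regular if for each closed set $F$ and each $x\notin F$ there exist disjoint $e^*$-$\theta$-open sets $U$ and $V$ with $F\subseteq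 U$ and $x\in V$. *)

(* Defs.v *)
From mathcomp Require Import all_boot all_classical topology.

Set Implicit Arguments.
Unset Strict Implicit.
Unset Printing Implicit Defensive.

Local Open Scope classical_set_scope.

Section EStarTheta.
Context {T : topologicalType}.
Implicit Types A : set T.

Definition delta_closure A : set T :=
  [set x | forall U : set T, open U -> U x -> interior (closure U) `&` A !=set0].

Definition estar_open A : Prop :=
  A `<=` closure (interior (delta_closure A)).

Definition estar_closed A : Prop := estar_open (~` A).

Definition estar_closure A : set T :=
  \bigcap_(C in [set C : set T | estar_closed C /\ A `<=` C]) C.

Definition estar_theta_closure A : set T :=
  [set x | forall U : set T, estar_open U -> U x -> estar_closure U `&` A !=set0].

Definition estar_theta_closed A : Prop := A = estar_theta_closure A.

Definition estar_theta_open A : Prop := estar_theta_closed (~` A).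

Definition gestar_theta_closed A : Prop :=
  forall U : set T, open U -> A `<=` U -> estar_theta_closure A `<=` U.

End EStarTheta.

Definition estar_theta_open_map (X Y : topologicalType) (f : X -> Y) : Prop :=
  forall U : set X, open U -> estar_theta_open (f @` U).

Definition gestar_theta_closed_map (X Y : topologicalType) (f : X -> Y) : Prop :=
  forall F : set X, closed F -> gestar_theta_closed (f @` F).

Definition estar_theta_regular (T : topologicalType) : Prop :=
  forall (F : set T) (x : T), closed F -> ~ F x ->
    exists U V : set T,
      [/\ estar_theta_open U, estar_theta_open V, F `<=` U, V x & U `&` V = set0].

(* The library's [regular_space] asks that every neighbourhood of a point
   contain the closure of a neighbourhood of it; it makes no T1 assumption and
   is the separation of points from closed sets by disjoint open sets. *)
Lemma regular_spaceP (T : topologicalType) :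
  regular_space T <->
  forall (F : set T) (x : T), closed F -> ~ F x ->
    exists U V : set T, [/\ open U, open V, F `<=` U, V x & U `&` V = set0].
Proof.
split=> [regT F x cF nFx|sepT x A].
  have : nbhs x (~` F) by apply: open_nbhs_nbhs; split=> //; exact: closed_openC.
  move=> /(regT x)[N]; rewrite nbhsE => -[V [oV Vx] VN] NF.
  exists (~` closure N), V; split=> //.
  - exact/closed_openC/closed_closure.
  - by move=> z Fz /NF.
  - apply/disjoints_subset => z nNz Vz.
    by apply: nNz; apply: subset_closure; exact: VN.
rewrite nbhs_simpl {1}nbhsE => -[B [oB Bx] BA].
have [||U [V [oU oV BU Vx UV]]] := sepT (~` B) x.
- exact: open_closedC.
- by apply.
exists V; first by apply: open_nbhs_nbhs; split.
apply: subset_trans BA => z clVz; apply: contrapT => /BU Uz.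
have /clVz[w [Vw Uw]] : nbhs z U by apply: open_nbhs_nbhs; split.
by have : (U `&` V) w by []; rewrite UV.
Qed.

(* Main.v *)
Require Import Defs.
From mathcomp Require Import all_boot all_classical topology.

(** If [f x = y] lies outside the closed set [F], regularity of [X] gives
    disjoint open [U] containing the preimage of [F] and [V] containing [x];
    then [f V] and the complement of [e*-cl_theta (f (X \ U))] separate [y] from
    [F]. The latter set is [e*-theta]-open because [e*-cl_theta] is idempotent,
    which holds since the [e*]-closure of an [e*]-open set is [e*]-open. *)

Local Open Scope classical_set_scope.

Section EStarThetaTheory.
Context {T : topologicalType}.
Implicit Types A B U : set T.

Lemma subset_delta_closure A : A `<=` delta_closure A.
Proof.
move=> x Ax U oU Ux; exists x; split=> //.
by suff /(_ x Ux) : U `<=` interior (closure U) by []; rewrite -open_subsetE //; exact: subset_closure.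
Qed.

Lemma delta_closureS A B : A `<=` B -> delta_closure A `<=` delta_closure B.
Proof. by move=> AB x clAx U oU /(clAx _ oU)[y [Uy /AB By]]; exists y. Qed.

Lemma closure_interior_delta_closureS A B : A `<=` B ->
  closure (interior (delta_closure A)) `<=`
  closure (interior (delta_closure B)).
Proof. by move=> AB; apply/closureS/interiorS/delta_closureS. Qed.

Lemma open_estar_open A : open A -> estar_open A.
Proof.
move=> oA; apply: subset_trans (@subset_closure _ _).
by rewrite -open_subsetE //; exact: subset_delta_closure.
Qed.

(* [A `&` closure (interior (delta_closure A))] is the [e*]-interior of [A]. *)
Lemma estar_open_core A :
  estar_open (A `&` closure (interior (delta_closure A))).
Proof.
set G := interior (delta_closure A).
have oG : open G by exact: open_interior.
suff GA : G `<=` interior (delta_closure (A `&` closure G)).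
  by apply: subset_trans (closureS GA) => x [].
rewrite -(open_subsetE _ oG) => x Gx W oW Wx.
(* Testing [x] against [W] intersected with [G], not [W] alone, forces the witness [y] into the
   closure of [G] as well. *)
have [y [WGy Ay]] := interior_subset Gx _ (openI oW oG) (conj Wx Gx).
exists y; split; first by apply: interiorS WGy; apply: closureS => z [].
by split=> //; have := interior_subset WGy; apply: closureS => z [].
Qed.

Lemma subset_estar_closure A : A `<=` estar_closure A.
Proof. by move=> x Ax C [_]; apply. Qed.

Lemma estar_closure_id A :
  estar_closure (estar_closure A) `<=` estar_closure A.
Proof. by move=> x clx C [cC AC]; apply: clx; split=> // y; apply. Qed.

(** The [estar_closure] of [U] is the union of [U] with the open complement of [K]: outside [U] it
    misses [K] because the [e*]-interior of the complement of [U] is [e*]-open. *)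
Lemma estar_open_closure U : estar_open U -> estar_open (estar_closure U).
Proof.
move=> oU z clUz.
have [Uz|nUz] := pselect (U z).
  exact: (closure_interior_delta_closureS _ _ (@subset_estar_closure U)) (oU z Uz).
set K := closure (interior (delta_closure (~` U))).
have nKz : (~` K) z.
  move=> Kz; suff : (~` (~` U `&` K)) z by apply.
  apply: clUz; split; first by rewrite /estar_closed setCK; exact: estar_open_core.
  by move=> y Uy [].
have KU : ~` K `<=` estar_closure U.
  move=> y nKy C [cC UC]; apply: contrapT => nCy; apply: nKy.
  by apply: (closure_interior_delta_closureS (~` C)); [exact: subsetC | exact: cC].
apply: (closure_interior_delta_closureS _ _ KU); apply: open_estar_open nKz.
exact/closed_openC/closed_closure.
Qed.

Lemma subset_estar_theta_closure A : A `<=` estar_theta_closure A.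
Proof.
by move=> x Ax U _ Ux; exists x; split=> //; exact: subset_estar_closure.
Qed.

Lemma estar_theta_closed_closure A :
  estar_theta_closed (estar_theta_closure A).
Proof.
apply/seteqP; split; first exact: subset_estar_theta_closure.
move=> x clx U oU Ux; have [y [Uy]] := clx U oU Ux.
(* The set [estar_closure U] itself now serves as the [e*]-open neighbourhood of [y]. *)
move=> /(_ _ (estar_open_closure _ oU) Uy)[z [/estar_closure_id Uz Az]].
by exists z.
Qed.

End EStarThetaTheory.

Theorem theorem4 (X Y : topologicalType) (f : X -> Y) :
  regular_space X ->
  continuous f ->
  set_surj [set: X] [set: Y] f ->
  estar_theta_open_map f ->
  gestar_theta_closed_map f ->
  estar_theta_regular Y.
Proof.
move=> /regular_spaceP regX cf surjf openf closedf F y cF nFy.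
have [x _ fxy] := surjf y I; rewrite -{}fxy in nFy *.
have cfF : closed (f @^-1` F) by move/continuous_closedP: cf; apply.
have [U [V [oU oV FU Vx UV0]]] := regX _ _ cfF nFy.
(* Since [U] contains the preimage of [F], the image of its complement lies in the open complement
   of [F]. *)
have FclU : estar_theta_closure (f @` (~` U)) `<=` ~` F.
  apply: closedf; [exact: open_closedC | exact: closed_openC |].
  by move=> _ [z nUz <-] /FU.
exists (~` estar_theta_closure (f @` (~` U))), (f @` V); split.
- by rewrite /estar_theta_open setCK; exact: estar_theta_closed_closure.
- exact: openf.
- by move=> z Fz /FclU.
- by exists x.
(* As [V] misses [U], the image of [V] lies in the image of the complement of [U], hence in its
   closure. *)
- apply/classical_sets.disjoints_subset; apply: subsetC.
  apply: subset_trans (@subset_estar_theta_closure _ _).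
  by apply: image_subset => z Vz Uz; have : (U `&` V) z by []; rewrite UV0.
Qed.
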